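(* Let $(M,\varphi,\xi,\eta,g)$ be a Kenmotsu manifold of dimension $2n+1$. If $g$ is a $*$-Ricci soliton, i.e. there are a vector field $V$ on $M$ and a constant $\lambda\in\mathbb{R}$ with $$\pounds_V g+2S^*+2\lambda g=0,$$ then the soliton constant satisfies $\lambda=0$.
   Context: All manifolds, tensors and functions are smooth; $\mathfrak{X}(M)$ denotes the vector fields on $M$; $\pounds$ is the Lie derivative; $\nabla$ is the Levi-Civita connection of $g$. An almost contact metric manifold $(M,\varphi,\xi,\eta,g)$ of dimension $2n+1$ ($n\ge 1$) is a smooth manifold with a $(1,1)$-tensor field $\varphi$, a vector field $\xi$ (the characteristic vector field), a 1-form $\eta$ and a Riemannian metric $g$ such that $\varphi^2=-I+\eta\otimes\xi$, $\eta(\xi)=1$ and $g(\varphi X,\varphi Y)=g(X,Y)-\eta(X)\eta(Y)$ for all $X,Y\in\mathfrak{X}(M)$. It is called Kenmotsu if $(\nabla_X\varphi)Y=g(\varphi X,Y)\xi-\eta(Y)\varphi X$ for all $X,Y\in\mathfrak{X}(M)$. The curvature convention is $R(X,Y)=[\nabla_X,\nabla_Y]-\nabla_{[X,Y]}$. The $*$-Ricci tensor is $S^*(X,Y)=\frac12\,\mathrm{trace}\big(Z\mapsto R(X,\varphi Y)\varphi Z\big)$. *)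

(* Defs.v *)
From HB Require Import structures.
From mathcomp Require Import all_boot all_order all_algebra.
From mathcomp Require Import all_classical all_reals all_analysis.
From mathcomp Require Import ring.

Set Implicit Arguments.
Unset Strict Implicit.
Unset Printing Implicit Defensive.

Import Order.TTheory GRing.Theory Num.Theory numFieldNormedType.Exports.

Local Open Scope classical_set_scope.
Local Open Scope ring_scope.

Section SmoothEuclidean.
Variables (R : realType) (m : nat).
Implicit Types (U : set 'rV[R]_m) (f g : 'rV[R]_m -> R).

Definition partial (i : 'I_m) f : 'rV[R]_m -> R :=
  fun x => 'D_(delta_mx 0 i) f x.

(* C^k on U: all iterated partial derivatives of order at most k exist and are
   continuous on U. Only used for open U. *)
Fixpoint Ck_on (k : nat) U f : Prop :=
  (forall x, U x -> {for x, continuous f}) /\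
  (if k is k'.+1 then
     forall i : 'I_m, (forall x, U x -> derivable f x (delta_mx 0 i)) /\
                      Ck_on k' U (partial i f)
   else True).

Definition smooth_on U f : Prop := forall k, Ck_on k U f.

Lemma Ck_onS k U f : Ck_on k.+1 U f -> Ck_on k U f.
Proof.
elim: k f => [|k IH] f [cf Df]; split=> // i.
by have [df /IH Dif] := Df i; split.
Qed.

Lemma Ck_on_eq k U f g : open U -> (forall x, U x -> f x = g x) ->
  Ck_on k U f -> Ck_on k U g.
Proof.
move=> oU.
have nfg f' g' x : (forall x, U x -> f' x = g' x) -> U x ->
    \forall y \near x, f' y = g' y.
  by move=> fg Ux; apply: filterS (open_nbhs_nbhs (conj oU Ux)) => y /fg.
have cfg f' g' x : (forall x, U x -> f' x = g' x) -> U x ->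
    {for x, continuous f'} -> {for x, continuous g'}.
  move=> fg Ux cf; rewrite /prop_for /continuous_at -fg //.
  apply: (cvg_trans (@near_eq_cvg _ _ (nbhs x) _ f' g' _)) cf.
  exact: nfg.
elim: k f g => [|k IH] f g fg [cf Df].
  by split=> // x Ux; exact: cfg (cf x Ux).
split=> [x Ux|i]; first exact: cfg (cf x Ux).
have [df Dif] := Df i; split=> [y Uy|].
  by apply: near_eq_derivable (df _ Uy); exact: nfg.
by apply: IH Dif => y Uy; apply: near_eq_derive; exact: nfg.
Qed.

Lemma Ck_on_cst k U (a : R) : open U -> Ck_on k U (fun=> a).
Proof.
move=> oU; elim: k a => [|k IH] a.
  by split=> // x _; exact: cst_continuous.
split=> [x _|i]; first exact: cst_continuous.
split=> [x _|]; first exact: derivable_cst.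
by apply: Ck_on_eq (IH 0) => // x _; rewrite /partial derive_cst.
Qed.

Lemma Ck_on_add k U f g : open U -> Ck_on k U f -> Ck_on k U g ->
  Ck_on k U (f + g).
Proof.
move=> oU; elim: k f g => [|k IH] f g [cf Df] [cg Dg].
  by split=> // x Ux; exact: continuousD (cf x Ux) (cg x Ux).
split=> [x Ux|i]; first exact: continuousD (cf x Ux) (cg x Ux).
have [df Dif] := Df i; have [dg Dig] := Dg i; split=> [y Uy|].
  by apply: derivableD; [exact: df|exact: dg].
apply: Ck_on_eq (IH _ _ Dif Dig) => // y Uy.
by rewrite /partial deriveD//; [exact: df|exact: dg].
Qed.

Lemma Ck_on_mul k U f g : open U -> Ck_on k U f -> Ck_on k U g ->
  Ck_on k U (f * g).
Proof.
move=> oU; elim: k f g => [|k IH] f g Cf Cg; have [cf Df] := Cf;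
  have [cg Dg] := Cg.
  by split=> // x Ux; exact: continuousM (cf x Ux) (cg x Ux).
split=> [x Ux|i]; first exact: continuousM (cf x Ux) (cg x Ux).
have [df Dif] := Df i; have [dg Dig] := Dg i; split=> [y Uy|].
  by apply: derivableM; [exact: df|exact: dg].
apply: Ck_on_eq (Ck_on_add oU (IH _ _ (Ck_onS Cf) Dig)
                              (IH _ _ (Ck_onS Cg) Dif)) => // y Uy.
by rewrite /partial deriveM//; [exact: df|exact: dg].
Qed.

End SmoothEuclidean.

(* Smooth manifolds of dimension m, presented by a (not necessarily maximal)
   smooth atlas. By convention manifolds are nonempty; connectedness is not
   required. *)
Record manifold (R : realType) (m : nat) := Manifold {
  carrier :> topologicalType;
  chart_index : Type;
  chart_dom : chart_index -> set carrier;
  chart : chart_index -> carrier -> 'rV[R]_m;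
  chart_inv : chart_index -> 'rV[R]_m -> carrier;
  chart_dom_open : forall i, open (chart_dom i);
  chart_img_open : forall i, open (chart i @` chart_dom i);
  chartK : forall i p, chart_dom i p -> chart_inv i (chart i p) = p;
  chart_continuous : forall i p, chart_dom i p ->
    {for p, continuous (chart i)};
  chart_inv_continuous : forall i x, (chart i @` chart_dom i) x ->
    {for x, continuous (chart_inv i)};
  chart_cover : forall p, exists i, chart_dom i p;
  chart_smooth : forall i j (k : 'I_m),
    smooth_on (chart i @` (chart_dom i `&` chart_dom j))
              (fun x => chart j (chart_inv i x) 0 k);
  manifold_hausdorff : hausdorff_space carrier;
  manifold_second_countable : @second_countable carrier;
  manifold_nonempty : [set: carrier] !=set0
}.

Section SmoothFunctions.
Variables (R : realType) (m : nat) (M : manifold R m).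

Definition smooth (f : M -> R) : Prop := forall i : chart_index M,
  smooth_on (chart i @` chart_dom i) (f \o chart_inv i).

Definition smooth_pred : {pred M -> R} := fun f => `[< smooth f >].

Lemma smooth_subring_closed : subring_closed smooth_pred.
Proof.
have oi i : open (@chart _ _ M i @` chart_dom i).
  exact: chart_img_open.
have sC a : smooth (fun=> a) by move=> i k; exact: Ck_on_cst.
have sM f g : smooth f -> smooth g -> smooth (f * g).
  by move=> sf sg i k; exact: Ck_on_mul (sf i k) (sg i k).
split=> [|f g /asboolP sf /asboolP sg|f g /asboolP sf /asboolP sg];
  apply/asboolP; [exact: (sC 1)| |exact: sM].
rewrite -mulN1r => i k; apply: Ck_on_add (sf i k) _ => //.
by apply: (sM (fun=> -1)).
Qed.

HB.instance Definition _ :=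
  GRing.isSubringClosed.Build (M -> R) smooth_pred smooth_subring_closed.

Record smooth_fun := SmoothFun {
  smooth_val :> M -> R;
  _ : smooth_val \in smooth_pred
}.

HB.instance Definition _ := [isSub for smooth_val].
HB.instance Definition _ := [Choice of smooth_fun by <:].
HB.instance Definition _ := GRing.SubChoice_isSubComPzRing.Build
  (M -> R) smooth_pred smooth_fun smooth_subring_closed.

Lemma smooth_fun_oner_neq0 : (1 : smooth_fun) != 0.
Proof.
have [p _] := manifold_nonempty M.
apply/eqP => /(congr1 (fun f : smooth_fun => f p)) /eqP.
by rewrite /= oner_eq0.
Qed.

HB.instance Definition _ :=
  GRing.PzSemiRing_isNonZero.Build smooth_fun smooth_fun_oner_neq0.

Lemma smooth_cst_subproof (a : R) : (fun=> a) \in smooth_pred.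
Proof. by apply/asboolP => i k; apply: Ck_on_cst; exact: chart_img_open. Qed.

Definition smooth_cst (a : R) : smooth_fun := SmoothFun (smooth_cst_subproof a).

End SmoothFunctions.

Section VectorFields.
Variables (R : realType) (m : nat) (M : manifold R m).
Local Notation C := (smooth_fun M).

(* Tangent vectors at p are the derivations of C^oo(M) at p, and vector fields
   are the R-linear derivations of the algebra C^oo(M). *)
Definition tangent_vector (p : M) (v : C -> R) : Prop :=
  (forall (a : R) (f g : C), v (smooth_cst M a * f + g) = a * v f + v g) /\
  (forall f g : C, v (f * g) = v f * g p + f p * v g).

Definition derivation (D : C -> C^o) : Prop :=
  (forall (a : R) (f g : C),
     D (smooth_cst M a * f + g) = smooth_cst M a * D f + D g) /\
  (forall f g : C, D (f * g) = D f * g + f * D g).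

Lemma derivationD (D : C -> C^o) :
  derivation D -> forall f g : C, D (f + g) = D f + D g.
Proof.
have e1 : smooth_cst M 1 = 1 by exact: val_inj.
by case=> lD _ f g; have := lD 1 f g; rewrite e1 !mul1r.
Qed.

Definition derivation_pred : {pred C -> C^o} := fun D => `[< derivation D >].

Lemma derivation_submod_closed : submod_closed derivation_pred.
Proof.
split=> [|h D D' /asboolP[lD mD] /asboolP[lD' mD']]; apply/asboolP; split.
- by move=> a f g; rewrite /= mulr0 addr0.
- by move=> f g; rewrite /= mulr0 mul0r addr0.
- move=> a f g; rewrite !fctE /= lD lD' /GRing.scale /=.
  by rewrite !mulrDr [h * (_ * _)]mulrCA addrACA.
- move=> f g; rewrite !fctE /= mD mD' /GRing.scale /=.
  by rewrite mulrDr mulrDl mulrDr mulrA [f * (h * _)]mulrCA addrACA.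
Qed.

HB.instance Definition _ := GRing.isSubmodClosed.Build C (C -> C^o)
  derivation_pred derivation_submod_closed.

Record vector_field := VectorField {
  vector_field_val :> C -> C^o;
  _ : vector_field_val \in derivation_pred
}.

HB.instance Definition _ := [isSub for vector_field_val].
HB.instance Definition _ := [Choice of vector_field by <:].
HB.instance Definition _ := [SubChoice_isSubLmodule of vector_field by <:].

Lemma lie_bracket_subproof (X Y : vector_field) :
  (fun f : C => X (Y f) - Y (X f) : C^o) \in derivation_pred.
Proof.
case: X Y => [X /asboolP[lX mX]] [Y /asboolP[lY mY]] /=.
apply/asboolP; split=> [a f g|f g].
  by rewrite /= lY lX lX lY mulrBr opprD addrACA.
rewrite mY mX.
rewrite (derivationD (conj lX mX)) (derivationD (conj lY mY)) !mX !mY.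
by ring.
Qed.

Definition lie_bracket (X Y : vector_field) : vector_field :=
  VectorField (lie_bracket_subproof X Y).

End VectorFields.

(* Tensor fields are taken as C^oo(M)-multilinear maps on vector fields. *)
Section Geometry.
Variables (R : realType) (m : nat) (M : manifold R m).
Local Notation C := (smooth_fun M).
Local Notation X := (vector_field M).

Definition nonzero_at (p : M) (U : X) : Prop := exists f : C, U f p != 0.

Record riemannian_metric (g : X -> X -> C) : Prop := RiemannianMetric {
  metric_linear : forall (h : C) (U U' W : X),
    g (h *: U + U') W = h * g U W + g U' W;
  metric_sym : forall U W : X, g U W = g W U;
  metric_pos : forall (p : M) (U : X), nonzero_at p U -> 0 < g U U p
}.

Record affine_connection (nabla : X -> X -> X) : Prop := AffineConnection {
  connection_linear : forall (h : C) (U U' W : X),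
    nabla (h *: U + U') W = h *: nabla U W + nabla U' W;
  connection_additive : forall U W W' : X,
    nabla U (W + W') = nabla U W + nabla U W';
  connection_leibniz : forall (h : C) (U W : X),
    nabla U (h *: W) = (U h : C) *: W + h *: nabla U W
}.

Record levi_civita (g : X -> X -> C) (nabla : X -> X -> X) : Prop :=
  LeviCivita {
  levi_civita_connection : affine_connection nabla;
  levi_civita_torsion_free : forall U W : X,
    nabla U W - nabla W U = lie_bracket U W;
  levi_civita_compatible : forall U W Z : X,
    U (g W Z) = g (nabla U W) Z + g W (nabla U Z)
}.

Definition curvature (nabla : X -> X -> X) (U W Z : X) : X :=
  nabla U (nabla W Z) - nabla W (nabla U Z) - nabla (lie_bracket U W) Z.

(* (nabla_U T) W for a (1,1)-tensor field T. *)
Definition covariant_endo (nabla : X -> X -> X) (T : X -> X) (U W : X) : X :=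
  nabla U (T W) - T (nabla U W).

(* (L_V g)(U, W). *)
Definition lie_metric (V : X) (g : X -> X -> C) (U W : X) : C :=
  V (g U W) - g (lie_bracket V U) W - g U (lie_bracket V W).

(* The values of E_1, ..., E_m at p form a basis of the tangent space at p. *)
Definition frame_at (p : M) (E : 'I_m -> X) : Prop :=
  (forall c : 'I_m -> R,
     (forall f : C, \sum_i c i * E i f p = 0) -> forall i, c i = 0) /\
  (forall v : C -> R, tangent_vector p v ->
     exists c : 'I_m -> R, forall f : C, v f = \sum_i c i * E i f p).

(* t is the trace of the endomorphism of the tangent space at p induced by the
   (1,1)-tensor field A: the trace of its matrix a in some, equivalently any,
   frame at p. *)
Definition trace_at (p : M) (A : X -> X) (t : R) : Prop :=
  exists (E : 'I_m -> X) (a : 'M[R]_m),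
    [/\ frame_at p E,
        forall (j : 'I_m) (f : C), A (E j) f p = \sum_i a i j * E i f p
      & t = \tr a].

(* S is the *-Ricci tensor,
   S(U, W) = 1/2 trace (Z |-> R(U, phi W) (phi Z)). *)
Definition star_ricci (nabla : X -> X -> X) (phi : X -> X) (S : X -> X -> C) :
    Prop :=
  forall (U W : X) (p : M), exists2 t : R,
    trace_at p (fun Z => curvature nabla U (phi W) (phi Z)) t
    & S U W p = 2^-1 * t.

Definition star_ricci_soliton (g S : X -> X -> C) (V : X) (lambda : R) : Prop :=
  forall U W : X,
    lie_metric V g U W + 2 * S U W + 2 * (smooth_cst M lambda * g U W) = 0.

Record almost_contact_metric (phi : {linear X -> X}) (xi : X)
    (eta : {linear X -> C^o}) (g : X -> X -> C) : Prop := AlmostContactMetric {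
  acm_metric : riemannian_metric g;
  acm_phi2 : forall U : X, phi (phi U) = - U + (eta U : C) *: xi;
  acm_eta_xi : eta xi = 1 :> C;
  acm_compatible : forall U W : X,
    g (phi U) (phi W) = g U W - (eta U : C) * eta W
}.

(* nabla is meant to be the Levi-Civita connection of g. *)
Definition kenmotsu (phi : {linear X -> X}) (xi : X) (eta : {linear X -> C^o})
    (g : X -> X -> C) (nabla : X -> X -> X) : Prop :=
  forall U W : X, covariant_endo nabla phi U W =
    g (phi U) W *: xi - (eta W : C) *: phi U.

End Geometry.

(* Main.v *)
From HB Require Import structures.
Require Import Defs.
From mathcomp Require Import all_boot all_order all_algebra.
From mathcomp Require Import all_classical all_reals all_analysis.
From mathcomp Require Import ring.

(* Kenmotsu geometry makes the Lie derivatives along xi of all the structure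
   tensors explicit: with h = g - eta (x) eta one has L_xi g = 2 h,
   L_xi eta = 0, L_xi phi = 0, L_xi nabla = -2 h (x) xi, and hence
   L_xi R (U, V) W = -2 (h(V, W) U - h(U, W) V). Taking a trace, the star-Ricci
   tensor S satisfies L_xi S = -2 h. Moreover S(., xi) = 0 because phi xi = 0,
   so evaluating the soliton equation on (., xi) determines Z = [xi, V] through
   g, and [xi, Z] = -2 Z - 2 lambda xi. On the distribution ker eta, commuting
   L_xi with L_V in the soliton equation gives L_Z g = 4 g + 4 S; commuting L_xi
   with L_Z then gives 0 = L_xi (4 g + 4 S) = -4 lambda g on ker eta, which is
   nonzero because the dimension is at least 2. *)

Set Implicit Arguments.
Unset Strict Implicit.
Unset Printing Implicit Defensive.

Import Order.TTheory GRing.Theory Num.Theory numFieldNormedType.Exports.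

Local Open Scope ring_scope.

(** * Derivations, brackets and Lie derivatives of bilinear forms *)

Section VectorFieldCalculus.
Variables (R : realType) (m : nat) (M : manifold R m).
Local Notation C := (smooth_fun M).
Local Notation X := (vector_field M).
Implicit Types (U V W Z : X) (f h : C).

(* [vector_field M] acts on functions with values in [C^o]; [vderiv U f] is the
   same function with values in [C], where [ring] applies. *)
Definition vderiv U f : C := U f.

Lemma smooth_fun_ext f h : (forall p, f p = h p) -> f = h.
Proof. by move=> fh; apply: val_inj; apply: funext. Qed.

Lemma vector_field_ext U W : (forall f, vderiv U f = vderiv W f) -> U = W.
Proof. by move=> UW; apply: val_inj; apply: funext. Qed.

Lemma smooth_funM f h p : (f * h) p = f p * h p. Proof. by []. Qed.

Lemma smooth_fun_sum I (r : seq I) (P : pred I) (F : I -> C) p :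
  (\sum_(i <- r | P i) F i) p = \sum_(i <- r | P i) F i p.
Proof. by elim/big_rec2: _ => // i y x _ <-. Qed.

Lemma smooth_fun_mul2I f h : 2 * f = 2 * h -> f = h.
Proof.
move=> fh; apply: smooth_fun_ext => p.
move: (congr1 (fun k : C => k p) fh); change (2 * f p = 2 * h p -> f p = h p).
by apply: mulfI; rewrite pnatr_eq0.
Qed.

Lemma vderiv_derivation U : derivation (vderiv U).
Proof. by case: U => U dU; exact/asboolP. Qed.

Lemma vderivDr U f h : vderiv U (f + h) = vderiv U f + vderiv U h.
Proof. exact: (derivationD (vderiv_derivation U)). Qed.

Lemma vderivMr U f h : vderiv U (f * h) = vderiv U f * h + f * vderiv U h.
Proof. exact: (vderiv_derivation U).2. Qed.

Lemma vderiv0r U : vderiv U 0 = 0.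
Proof. by apply: (addrI (vderiv U 0)); rewrite -vderivDr !addr0. Qed.

Lemma vderiv1r U : vderiv U 1 = 0.
Proof.
by apply: (addrI (vderiv U 1)); rewrite addr0 -{3}[1]mulr1 vderivMr mulr1 mul1r.
Qed.

Lemma vderiv_cst U a : vderiv U (smooth_cst M a) = 0.
Proof.
have := (vderiv_derivation U).1 a 1 0.
by rewrite addr0 mulr1 vderiv1r mulr0 add0r vderiv0r.
Qed.

Lemma vderiv2r U f : vderiv U (2 * f) = 2 * vderiv U f.
Proof. by rewrite !mulr_natl !mulr2n vderivDr. Qed.

Lemma vderivNr U f : vderiv U (- f) = - vderiv U f.
Proof. by apply: (addIr (vderiv U f)); rewrite -vderivDr !addNr vderiv0r. Qed.

Lemma vderivBr U f h : vderiv U (f - h) = vderiv U f - vderiv U h.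
Proof. by rewrite vderivDr vderivNr. Qed.

Lemma vderivDl U W f : vderiv (U + W) f = vderiv U f + vderiv W f.
Proof. by []. Qed.

Lemma vderivNl U f : vderiv (- U) f = - vderiv U f. Proof. by []. Qed.

Lemma vderivZl h U f : vderiv (h *: U) f = h * vderiv U f. Proof. by []. Qed.

Lemma vderiv0l f : vderiv 0 f = 0. Proof. by []. Qed.

Lemma vderiv_suml I (r : seq I) (P : pred I) (F : I -> X) f :
  vderiv (\sum_(i <- r | P i) F i) f = \sum_(i <- r | P i) vderiv (F i) f.
Proof. by elim/big_rec2: _ => // i y x _ <-. Qed.

Lemma vderiv_sumr I (r : seq I) (P : pred I) U (F : I -> C) :
  vderiv U (\sum_(i <- r | P i) F i) = \sum_(i <- r | P i) vderiv U (F i).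
Proof.
by elim/big_rec2: _ => [|i y x _ <-]; rewrite ?vderiv0r ?vderivDr.
Qed.

Lemma vderiv_bracket U W f :
  vderiv (lie_bracket U W) f = vderiv U (vderiv W f) - vderiv W (vderiv U f).
Proof. by []. Qed.

Definition vderivE :=
  (vderivDl, vderivNl, vderivZl, vderiv0l, vderiv_bracket, vderivDr, vderivNr,
   vderivMr, vderiv0r).

Lemma bracketDr U W Z :
  lie_bracket Z (U + W) = lie_bracket Z U + lie_bracket Z W.
Proof. by apply: vector_field_ext => f; rewrite !vderivE; ring. Qed.

Lemma bracketNr U W : lie_bracket U (- W) = - lie_bracket U W.
Proof. by apply: vector_field_ext => f; rewrite !vderivE; ring. Qed.

Lemma bracket0r U : lie_bracket U 0 = 0.
Proof. by apply: vector_field_ext => f; rewrite !vderivE subrr. Qed.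

Lemma bracketZr U h W :
  lie_bracket U (h *: W) = vderiv U h *: W + h *: lie_bracket U W.
Proof. by apply: vector_field_ext => f; rewrite !vderivE; ring. Qed.

Lemma bracketC U W : lie_bracket U W = - lie_bracket W U.
Proof. by apply: vector_field_ext => f; rewrite !vderivE; ring. Qed.

Lemma bracket_sumr I (r : seq I) (P : pred I) U (F : I -> X) :
  lie_bracket U (\sum_(i <- r | P i) F i) =
  \sum_(i <- r | P i) lie_bracket U (F i).
Proof.
elim/big_rec2: _ => [|i y x _ <-]; last exact: bracketDr.
by apply: vector_field_ext => f; rewrite !vderivE subrr.
Qed.

Lemma jacobi U V W :
  lie_bracket U (lie_bracket V W) =
  lie_bracket (lie_bracket U V) W + lie_bracket V (lie_bracket U W).
Proof. by apply: vector_field_ext => f; rewrite !vderivE; ring. Qed.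

(** The Lie derivative of [B] along [V]; [B] is arbitrary so that it can be iterated and applied to
    both [g] and [S]. *)
Definition lie_form (B : X -> X -> C) (V U W : X) : C :=
  vderiv V (B U W) - B (lie_bracket V U) W - B U (lie_bracket V W).

Definition biadditive (B : X -> X -> C) : Prop :=
  (forall U U' W, B (U + U') W = B U W + B U' W) /\
  (forall U W W', B U (W + W') = B U W + B U W').

(** This is [[L_U, L_V] = L_[U, V]]: the Jacobi identity splits the double brackets and the mixed
    terms cancel. *)
Lemma lie_form_commutator (B : X -> X -> C) U V W Z : biadditive B ->
  lie_form (lie_form B V) U W Z =
  lie_form (lie_form B U) V W Z + lie_form B (lie_bracket U V) W Z.
Proof.
case=> Bl Br; rewrite /lie_form (jacobi U V W) (jacobi U V Z) !Bl !Br !vderivE.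
by ring.
Qed.
End VectorFieldCalculus.

Arguments vderiv : simpl never.

(** * Evaluation at a point as a ring morphism, hence compatible with determinants and adjugates *)

Section Evaluation.
Variables (R : realType) (m : nat) (M : manifold R m).

Definition smooth_eval (p : M) (f : smooth_fun M) : R := f p.

Lemma smooth_eval_is_zmod_morphism p : zmod_morphism (smooth_eval p).
Proof. by []. Qed.

Lemma smooth_eval_is_monoid_morphism p : monoid_morphism (smooth_eval p).
Proof. by []. Qed.

HB.instance Definition _ p := GRing.isZmodMorphism.Build _ _ (smooth_eval p)
  (smooth_eval_is_zmod_morphism p).
HB.instance Definition _ p := GRing.isMonoidMorphism.Build _ _ (smooth_eval p)
  (smooth_eval_is_monoid_morphism p).
End Evaluation.

(** * Frames with cleared denominators, and traces computed in them *)

Section LocalTrace.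
Variables (R : realType) (m : nat) (M : manifold R m).
Local Notation C := (smooth_fun M).
Local Notation X := (vector_field M).
Implicit Types (E F : 'I_m -> X) (D : C) (f : 'I_m -> C) (w : 'M[C]_m).

Lemma tangent_vector_deriv (Z : X) (p : M) :
  tangent_vector p (fun h => vderiv Z h p).
Proof.
split=> [a f h|f h]; last by rewrite vderivMr.
by rewrite vderivDr vderivMr vderiv_cst mul0r add0r.
Qed.

(** Functions are added one at a time. A nonzero [c] in the left kernel of the current Jacobian is,
    by independence of the frame, detected by some [h]; the column of [h] removes [c] from the
    kernel and raises the rank. *)
Lemma frame_jacobian_rank p E k : frame_at p E -> (k <= m)%N ->
  exists f : 'I_k -> C, \rank (\matrix_(i, j) vderiv (E i) (f j) p) = k.
Proof.
case=> indE _; elim: k => [|k IH] km.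
  by exists (fun=> 0); apply/eqP; rewrite -leqn0 rank_leq_col.
have [f rk] := IH (ltnW km).
set J := \matrix_(i, j) _ in rk.
have kerJ : kermx J != 0.
  by rewrite -mxrank_eq0 mxrank_ker rk subn_eq0 -ltnNge.
have [c cJ c0] : exists2 c : 'rV_m, c *m J = 0 & c != 0.
  exists (nz_row (kermx J)); last by rewrite nz_row_eq0.
  by apply/sub_kermxP; exact: nz_row_sub.
have [h ch] : exists h : C, \sum_i c 0 i * vderiv (E i) h p != 0.
  apply: contrapT => noh; move/eqP: c0; apply; apply/rowP => i; rewrite mxE.
  apply: (indE (c 0)) => h; apply/eqP; apply: contrapT => /negP ch.
  by apply: noh; exists h.
pose v : 'cV[R]_m := \col_i vderiv (E i) h p.
rewrite -[k.+1]addn1.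
pose f' (j : 'I_(k + 1)) :=
  match fintype.split j with inl j' => f j' | inr _ => h end.
exists f'.
have -> : \matrix_(i, j) vderiv (E i) (f' j) p = row_mx J v.
  apply/matrixP => i j; rewrite !mxE /f'.
  by case: fintype.split => j'; rewrite mxE.
set J' := row_mx J v; apply/eqP; rewrite eqn_leq rank_leq_col /=.
suff rJ' : (\rank J < \rank J')%N.
  by apply: leq_trans rJ'; rewrite rk addn1.
have kerJ' : (kermx J' < kermx J)%MS.
  apply/andP; split.
    apply/sub_kermxP; have := mulmx_ker J'.
    by rewrite mul_mx_row -[0 in RHS]row_mx0 => /eq_row_mx[].
  apply/negP => /(submx_trans (introT sub_kermxP cJ)) /sub_kermxP.
  rewrite mul_mx_row cJ -[0 in RHS]row_mx0 => /eq_row_mx[_] /matrixP /(_ 0 0).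
  rewrite !mxE => cv; move/eqP: ch; apply; rewrite -[RHS]cv.
  by apply: eq_bigr => i _; rewrite mxE.
move: kerJ'; rewrite ltmxErank => /andP[_]; rewrite !mxrank_ker.
by rewrite ltn_sub2lE // rank_leq_row.
Qed.

(** A one-form built from differentials of global functions, so that it acts on global vector fields
    without charts; [w] stands for a multiple of the inverse Jacobian. *)
Definition coframe f w (i : 'I_m) (Z : X) : C :=
  \sum_j vderiv Z (f j) * w j i.

(* [E] is a frame with dual coframe [D^-1 * coframe f w] where [D] does not
   vanish; clearing the denominator [D] makes all the data global. *)
Record local_frame D E f w : Prop := LocalFrame {
  coframe_dual : forall i j, coframe f w i (E j) = D * (i == j)%:R;
  coframe_span : forall Z, D *: Z = \sum_i coframe f w i Z *: E i;
  coframe_vanish : forall q i j, D q = 0 -> w i j q = 0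
}.

Lemma local_frame_exists (p : M) :
  (forall q, exists F : 'I_m -> X, frame_at q F) ->
  exists D E f w, local_frame D E f w /\ D p != 0.
Proof.
move=> frames; have [E Ep] := frames p.
have [f rk] := frame_jacobian_rank Ep (leqnn m).
pose J : 'M[C]_m := \matrix_(i, j) vderiv (E i) (f j).
have evJ q : map_mx (smooth_eval q) J = \matrix_(i, j) vderiv (E i) (f j) q.
  by apply/matrixP => i j; rewrite !mxE.
have evd q : (\det J) q = \det (map_mx (smooth_eval q) J).
  by rewrite det_map_mx.
(* Cramer's rule, with an extra factor [\det J] in [D] and [w]: it makes [w] vanish wherever [D]
   does, where the spanning identity reads [0 = 0]. *)
exists (\det J * \det J), E, f, (\det J *: \adj J).
split; last first.
  rewrite smooth_funM mulf_eq0 orbb evd evJ -unitfE -unitmxE.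
  by rewrite -row_free_unit /row_free rk.
split=> [i j|Z|q i j].
- transitivity (\det J * (J *m \adj J) j i); last first.
    by rewrite mul_mx_adj mxE eq_sym -mulrA mulr_natr.
  rewrite /coframe mxE mulr_sumr; apply: eq_bigr => k _.
  by rewrite !mxE mulrCA.
- apply: vector_field_ext => h; apply: smooth_fun_ext => q.
  rewrite vderiv_suml smooth_fun_sum vderivZl.
  have cfE i : coframe f (\det J *: \adj J) i Z q =
      (\det J) q * ((\row_j vderiv Z (f j) q) *m
                    \adj (map_mx (smooth_eval q) J)) 0 i.
    rewrite mxE mulr_sumr smooth_fun_sum; apply: eq_bigr => j _.
    rewrite smooth_funM mxE smooth_funM mulrCA -map_mx_adj [in RHS]mxE.
    by rewrite [in RHS]mxE.
  have [d0|d0] := eqVneq ((\det J) q) 0.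
    rewrite !smooth_funM d0 !mul0r big1 // => i _.
    by rewrite vderivZl smooth_funM cfE d0 !mul0r.
  have [F [_ spanF]] := frames q.
  have [z zF] := spanF _ (tangent_vector_deriv Z q).
  have /choice[c cF] i := spanF _ (tangent_vector_deriv (E i) q).
  pose K : 'M[R]_m := \matrix_(i, j) c i j.
  (* In a frame [F] at [q] the Jacobian factors through [K], so [K] is invertible where [\det J] is
     nonzero, and the [E i] span there. *)
  have Ku : K \in unitmx.
    have : map_mx (smooth_eval q) J \in unitmx by rewrite unitmxE -evd unitfE.
    suff -> : map_mx (smooth_eval q) J =
        K *m (\matrix_(i, j) vderiv (F i) (f j) q).
      by rewrite unitmx_mul => /andP[].
    apply/matrixP => i j; rewrite evJ !mxE cF.
    by apply: eq_bigr => k _; rewrite !mxE.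
  have [y yK] : exists y, y *m K = \row_i z i.
    by exists ((\row_i z i) *m invmx K); rewrite mulmxKV.
  have ZE k : vderiv Z k q = \sum_i y 0 i * vderiv (E i) k q.
    rewrite zF; under [RHS]eq_bigr => i _ do rewrite cF mulr_sumr.
    rewrite exchange_big /=; apply: eq_bigr => j _.
    under eq_bigr => i _ do rewrite mulrA.
    rewrite -mulr_suml; congr (_ * _).
    have /rowP/(_ j) := yK; rewrite !mxE => <-.
    by apply: eq_bigr => i _; rewrite mxE.
  have -> : (\det J * \det J * vderiv Z h) q =
      (\det J) q * ((\det J) q * vderiv Z h q) by rewrite !smooth_funM mulrA.
  rewrite ZE !mulr_sumr; apply: eq_bigr => i _.
  rewrite vderivZl smooth_funM cfE -mulrA; congr (_ * _); rewrite mulrA.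
  congr (_ * _).
  have -> : \row_j vderiv Z (f j) q = y *m map_mx (smooth_eval q) J.
    apply/rowP => j; rewrite evJ !mxE ZE.
    by apply: eq_bigr => k _; rewrite [in RHS]mxE.
  by rewrite -mulmxA mul_mx_adj mul_mx_scalar mxE -evd.
- rewrite smooth_funM => /eqP; rewrite mulf_eq0 orbb => /eqP d0.
  by rewrite mxE smooth_funM d0 mul0r.
Qed.

Definition frame_trace E f w (A : X -> X) : C :=
  \sum_i coframe f w i (A (E i)).

Lemma coframe_linear f w i h U W :
  coframe f w i (h *: U + W) = h * coframe f w i U + coframe f w i W.
Proof.
rewrite mulr_sumr -big_split; apply: eq_bigr => j _ /=.
by rewrite !vderivE; ring.
Qed.

Lemma coframe0 f w i : coframe f w i 0 = 0.
Proof. by apply: big1 => j _; rewrite vderiv0l mul0r. Qed.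

Lemma coframeD f w i U W :
  coframe f w i (U + W) = coframe f w i U + coframe f w i W.
Proof. by rewrite -{1}[U]scale1r coframe_linear mul1r. Qed.

Lemma coframeZ f w i h U : coframe f w i (h *: U) = h * coframe f w i U.
Proof. by rewrite -[h *: U]addr0 coframe_linear coframe0 addr0. Qed.

Lemma coframe_sum f w i I (r : seq I) (P : pred I) (F : I -> X) :
  coframe f w i (\sum_(j <- r | P j) F j) =
  \sum_(j <- r | P j) coframe f w i (F j).
Proof.
elim/big_rec2: _ => [|j y x _ <-]; first exact: coframe0.
exact: coframeD.
Qed.

Definition tensorial (V : lmodType C) (A : X -> V) : Prop :=
  forall (h : C) (U W : X), A (h *: U + W) = h *: A U + A W.

Lemma tensorial0 (V : lmodType C) (A : X -> V) : tensorial A -> A 0 = 0.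
Proof.
by move=> lA; apply: (addrI (A 0)); rewrite -{1}[A 0]scale1r -lA scaler0 !addr0.
Qed.

Lemma tensorial_sum (V : lmodType C) (A : X -> V) : tensorial A ->
  forall I (r : seq I) (P : pred I) (c : I -> C) (F : I -> X),
  A (\sum_(i <- r | P i) c i *: F i) = \sum_(i <- r | P i) c i *: A (F i).
Proof.
move=> lA I r P c F; elim/big_rec2: _ => [|i y x _ <-]; first exact: tensorial0.
exact: lA.
Qed.

Lemma tensorialZ (V : lmodType C) (A : X -> V) h U : tensorial A ->
  A (h *: U) = h *: A U.
Proof. by move=> lA; rewrite -[h *: U]addr0 lA tensorial0 // addr0. Qed.

(** Where [D] vanishes both sides do. Elsewhere the frame supplied by [trace_at] may differ from
    [E], and the trace is invariant under the change of basis [e]. *)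
Lemma frame_traceE D E f w (A : X -> X) (t : C) :
  local_frame D E f w -> tensorial A -> (forall q, trace_at q A (t q)) ->
  frame_trace E f w A = D * t.
Proof.
move=> [_ span vanish] lA trA; apply: smooth_fun_ext => q.
rewrite smooth_fun_sum smooth_funM.
have [D0|D0] := eqVneq (D q) 0.
  rewrite D0 mul0r big1 // => i _; rewrite smooth_fun_sum big1 // => j _.
  by rewrite smooth_funM vanish ?mulr0.
have [F [a' [[indF _] AF ->]]] := trA q.
pose e : 'M[R]_m := \matrix_(i, j) coframe f w j (F i) q.
pose a : 'M[R]_m := \matrix_(i, j) coframe f w j (A (E i)) q.
have eu : e \in unitmx.
  rewrite -row_free_unit -kermx_eq0; apply/rowV0P => c /sub_kermxP ce.
  apply/rowP => i; rewrite mxE; apply: (indF (c 0)) => h.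
  apply: (mulfI D0); rewrite mulr0 mulr_sumr.
  have DF j : D q * (c 0 j * vderiv (F j) h q) =
      \sum_k c 0 j * e j k * vderiv (E k) h q.
    have := congr1 (fun Z => vderiv Z h q) (span (F j)).
    rewrite vderivZl vderiv_suml smooth_fun_sum smooth_funM mulrCA => ->.
    rewrite mulr_sumr; apply: eq_bigr => k _.
    by rewrite vderivZl smooth_funM mxE mulrA.
  under eq_bigr => j _ do rewrite DF.
  rewrite exchange_big big1 //= => k _; rewrite -mulr_suml.
  by have /rowP/(_ k) := ce; rewrite !mxE => ->; rewrite mul0r.
(* [trace_at] keeps the coefficients of an image in a column, [a] in a row, hence the transpose;
   [D q] balances the denominator cleared in [a]. *)
have conj : D q *: (a'^T *m e) = e *m a.
  apply/matrixP => i k; rewrite !mxE.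
  transitivity ((D * coframe f w k (A (F i))) q).
    rewrite smooth_funM; congr (_ * _); rewrite smooth_fun_sum.
    under [RHS]eq_bigr => j _ do rewrite smooth_funM [vderiv _ _ q]AF mulr_suml.
    rewrite exchange_big; apply: eq_bigr => l _; rewrite !mxE smooth_fun_sum.
    by rewrite mulr_sumr; apply: eq_bigr => j _; rewrite smooth_funM mulrA.
  rewrite -coframeZ -tensorialZ // span tensorial_sum // coframe_sum.
  rewrite smooth_fun_sum; apply: eq_bigr => j _.
  by rewrite coframeZ !mxE.
have -> : \sum_i coframe f w i (A (E i)) q = \tr a.
  by apply: eq_bigr => i _; rewrite mxE.
rewrite -(mulKmx eu a) -conj -scalemxAr mxtraceZ mxtrace_mulC -mulmxA.
by rewrite mulmxV // mulmx1 mxtrace_tr.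
Qed.

(** Apply [theta] to the expansion of [D *: U] in the frame. *)
Lemma frame_trace_rank1 D E f w (theta : X -> C^o) (U : X) :
  local_frame D E f w -> tensorial theta ->
  frame_trace E f w (fun Z => theta Z *: U) = D * theta U.
Proof.
move=> [_ span _] lt; rewrite -[RHS]/(D *: theta U) -tensorialZ // span.
rewrite tensorial_sum //.
by apply: eq_bigr => i _; rewrite coframeZ mulrC.
Qed.

(* [frame_trace E f w A] is [D] times the trace of [A], whence the second
   summand. *)
Lemma frame_trace_lie D E f w (A : X -> X) (xi : X) :
  local_frame D E f w -> tensorial A ->
  D * frame_trace E f w (fun Z => lie_bracket xi (A Z) - A (lie_bracket xi Z)) =
  D * vderiv xi (frame_trace E f w A) - vderiv xi D * frame_trace E f w A.
Proof.
move=> [dual span _] lA.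
pose a i j := coframe f w j (A (E i)).
pose k i j := coframe f w j (lie_bracket xi (E i)).
(* Bracket the expansion of [D *: A (E i)] with [xi] and take the [i]-th coefficient; by duality,
   derivatives of coefficients survive only on the diagonal. *)
have bracketE i : D * coframe f w i (lie_bracket xi (A (E i))) =
    D * vderiv xi (a i i) - vderiv xi D * a i i + \sum_j a i j * k j i.
  have := congr1 (fun Z => coframe f w i (lie_bracket xi Z)) (span (A (E i))).
  rewrite /= bracketZr coframe_linear coframeZ bracket_sumr coframe_sum.
  under [X in _ = X -> _]eq_bigr => j _
    do rewrite bracketZr coframe_linear coframeZ dual.
  rewrite big_split /= (bigD1 i) //= eqxx big1; last first.
    by move=> j /negPf; rewrite eq_sym => ->; rewrite !mulr0.
  move=> e; rewrite -[LHS](addKr (vderiv xi D * coframe f w i (A (E i)))) e.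
  by rewrite mulr1 addr0 [vderiv _ _ * D]mulrC addrA [- _ + _]addrC.
have AE i : D * coframe f w i (A (lie_bracket xi (E i))) = \sum_j k i j * a j i.
  rewrite -coframeZ -tensorialZ // span tensorial_sum // coframe_sum.
  by apply: eq_bigr => j _; rewrite coframeZ.
have subE i : D *
    coframe f w i (lie_bracket xi (A (E i)) - A (lie_bracket xi (E i))) =
    D * vderiv xi (a i i) - vderiv xi D * a i i +
    (\sum_j a i j * k j i - \sum_j k i j * a j i).
  rewrite -scaleN1r addrC coframe_linear mulrDr bracketE mulrCA AE; ring.
(* A commutator of matrices has trace zero. *)
have comm : \sum_i (\sum_j a i j * k j i - \sum_j k i j * a j i) = 0.
  rewrite sumrB [X in X - _]exchange_big -sumrB big1 //= => i _.
  by rewrite -sumrB big1 // => j _; rewrite mulrC subrr.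
rewrite {1}/frame_trace mulr_sumr (eq_bigr _ (fun i _ => subE i)) big_split /=.
by rewrite comm addr0 sumrB /frame_trace vderiv_sumr !mulr_sumr.
Qed.

End LocalTrace.

(** * Rules for the metric, the Levi-Civita connection and its curvature *)

Section LeviCivita.
Variables (R : realType) (m : nat) (M : manifold R m).
Local Notation C := (smooth_fun M).
Local Notation X := (vector_field M).
Variables (g : X -> X -> C) (nabla : X -> X -> X).
Hypotheses (hg : riemannian_metric g) (hnabla : levi_civita g nabla).
Implicit Types (U V W Z : X) (h : C).

Let hconn := levi_civita_connection hnabla.

Lemma metricC U W : g U W = g W U. Proof. exact: (Defs.metric_sym hg). Qed.

Lemma metric0l W : g 0 W = 0.
Proof.
have := metric_linear hg 1 0 0 W; rewrite scaler0 addr0 mul1r => e.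
by apply: (addrI (g 0 W)); rewrite -e addr0.
Qed.

Lemma metricZl h U W : g (h *: U) W = h * g U W.
Proof. by rewrite -[h *: U]addr0 (metric_linear hg) metric0l addr0. Qed.

Lemma metricDl U U' W : g (U + U') W = g U W + g U' W.
Proof. by rewrite -{1}[U]scale1r (metric_linear hg) mul1r. Qed.

Lemma metricNl U W : g (- U) W = - g U W.
Proof. by rewrite -scaleN1r metricZl mulN1r. Qed.

Lemma metric0r W : g W 0 = 0. Proof. by rewrite metricC metric0l. Qed.

Lemma metricZr h U W : g W (h *: U) = h * g W U.
Proof. by rewrite ![g W _]metricC metricZl. Qed.

Lemma metricDr U U' W : g W (U + U') = g W U + g W U'.
Proof. by rewrite ![g W _]metricC metricDl. Qed.

Lemma metricNr U W : g W (- U) = - g W U.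
Proof. by rewrite ![g W _]metricC metricNl. Qed.

Definition metricE := (metricDl, metricNl, metricZl, metric0l,
                       metricDr, metricNr, metricZr, metric0r).

Lemma metric_eq0 U : g U U = 0 -> U = 0.
Proof.
move=> gU; apply: vector_field_ext => f; apply: smooth_fun_ext => p.
rewrite vderiv0l; apply/eqP; apply: contrapT => /negP Ufp.
have := metric_pos hg (ex_intro (fun f => U f p != 0) f Ufp).
by rewrite gU ltxx.
Qed.

Lemma metric_ext U W : (forall Z, g U Z = g W Z) -> U = W.
Proof.
move=> UW; apply/eqP; rewrite -subr_eq0; apply/eqP/metric_eq0.
by rewrite metricDl metricNl UW subrr.
Qed.

Lemma nabla0l W : nabla 0 W = 0.
Proof.
have := connection_linear hconn 1 0 0 W; rewrite scaler0 addr0 scale1r => e.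
by apply: (addrI (nabla 0 W)); rewrite -e addr0.
Qed.

Lemma nablaZl h U W : nabla (h *: U) W = h *: nabla U W.
Proof.
by rewrite -[h *: U]addr0 (connection_linear hconn) nabla0l addr0.
Qed.

Lemma nablaDl U U' W : nabla (U + U') W = nabla U W + nabla U' W.
Proof.
by rewrite -{1}[U]scale1r (connection_linear hconn) scale1r.
Qed.

Lemma nablaDr U W W' : nabla U (W + W') = nabla U W + nabla U W'.
Proof. exact: (connection_additive hconn). Qed.

Lemma nablaZr h U W : nabla U (h *: W) = vderiv U h *: W + h *: nabla U W.
Proof. exact: (connection_leibniz hconn). Qed.

Lemma nabla0r U : nabla U 0 = 0.
Proof. by apply: (addrI (nabla U 0)); rewrite -nablaDr !addr0. Qed.

Lemma nablaNr U W : nabla U (- W) = - nabla U W.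
Proof. by apply: (addIr (nabla U W)); rewrite -nablaDr !addNr nabla0r. Qed.

Lemma bracket_nabla U W : lie_bracket U W = nabla U W - nabla W U.
Proof. by rewrite (levi_civita_torsion_free hnabla). Qed.

Lemma vderiv_metric U W Z :
  vderiv U (g W Z) = g (nabla U W) Z + g W (nabla U Z).
Proof. exact: (levi_civita_compatible hnabla). Qed.

Lemma curvature_tensorial U W : tensorial (curvature nabla U W).
Proof.
move=> h Z Z'; rewrite /curvature !(nablaDr, nablaZr).
by apply: vector_field_ext => f; rewrite !vderivE; ring.
Qed.

Lemma curvature0 U Z : curvature nabla U 0 Z = 0.
Proof. by rewrite /curvature bracket0r !nabla0l nabla0r !subr0. Qed.
End LeviCivita.

(** * Structure tensors of a Kenmotsu manifold and their Lie derivatives along [xi] *)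

Section Kenmotsu.
Variables (R : realType) (m : nat) (M : manifold R m).
Local Notation C := (smooth_fun M).
Local Notation X := (vector_field M).
Variables (phi : {linear X -> X}) (xi : X) (eta : {linear X -> C^o}).
Variables (g : X -> X -> C) (nabla : X -> X -> X).
Hypotheses (hacm : almost_contact_metric phi xi eta g).
Hypotheses (hnabla : levi_civita g nabla).
Hypotheses (hken : kenmotsu phi xi eta g nabla).
Implicit Types (U V W Z : X) (h : C).

Let hg := acm_metric hacm.
Let metricE := metricE hg.

(** The formula for [phi] squared, applied at [xi] and at [phi xi], gives
    [phi xi = eta (phi xi) *: xi] with [eta (phi xi)] of square zero; that function vanishes
    pointwise. *)
Lemma phi_xi : phi xi = 0.
Proof.
have phi2xi : phi (phi xi) = 0.
  by rewrite (acm_phi2 hacm) (acm_eta_xi hacm) scale1r addNr.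
have phiE : phi xi = (eta (phi xi) : C) *: xi.
  apply: (addrI (- phi xi)); rewrite addNr -[LHS](linear0 phi) -phi2xi.
  exact: acm_phi2 hacm (phi xi).
have sqr0 : (eta (phi xi) : C) * eta (phi xi) = 0.
  have := congr1 eta phi2xi; rewrite {1}phiE linearZ /= linearZ /= linear0.
  by [].
rewrite phiE (_ : eta (phi xi) = 0) ?scale0r //.
apply: smooth_fun_ext => p; apply/eqP.
have := congr1 (fun f : C => f p) sqr0; rewrite smooth_funM => /eqP.
by rewrite mulf_eq0 orbb.
Qed.

Lemma etaE U : eta U = g U xi :> C.
Proof.
have /eqP := acm_compatible hacm U xi.
rewrite phi_xi (metric0r hg) (acm_eta_xi hacm) mulr1 eq_sym subr_eq0.
by move/eqP.
Qed.

Lemma metric_xi : g xi xi = 1.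
Proof. by rewrite -etaE; exact: acm_eta_xi hacm. Qed.

Lemma phi2 U : phi (phi U) = - U + g U xi *: xi.
Proof. by rewrite -etaE; exact: acm_phi2 hacm U. Qed.

Lemma metric_phi U W : g (phi U) (phi W) = g U W - g U xi * g W xi.
Proof. by rewrite -!etaE; exact: acm_compatible hacm U W. Qed.

Lemma metric_phi_xi U : g (phi U) xi = 0.
Proof.
have : phi (phi (phi U)) = - phi U.
  by rewrite (phi2 U) linearD linearN linearZ /= phi_xi scaler0 addr0.
rewrite phi2 => /(congr1 (g^~ xi)) /= /eqP.
by rewrite !metricE metric_xi mulr1 -subr_eq0 opprK addrAC addNr add0r => /eqP.
Qed.

(** The Kenmotsu identity at [xi] gives [phi (nabla U xi) = phi U]. Applying [phi] again recovers
    [nabla U xi], which is orthogonal to [xi] because [xi] has unit length. *)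
Lemma nabla_xi U : nabla U xi = U - g U xi *: xi.
Proof.
have := hken U xi; rewrite /covariant_endo phi_xi (nabla0r hnabla) sub0r.
rewrite metric_phi_xi scale0r sub0r (acm_eta_xi hacm) scale1r => /oppr_inj.
move/(congr1 phi); rewrite !phi2.
have -> : g (nabla U xi) xi = 0.
  apply: smooth_fun_mul2I; rewrite mulr0 mulrDl mul1r.
  rewrite {2}(metricC hg) -(vderiv_metric hnabla) metric_xi.
  exact: vderiv1r.
by rewrite scale0r addr0 => /(congr1 -%R); rewrite opprK opprD opprK.
Qed.

Definition hmetric U W : C := g U W - g U xi * g W xi.

Lemma hmetricC U W : hmetric U W = hmetric W U.
Proof. by rewrite /hmetric (metricC hg) mulrC. Qed.

Lemma hmetric_linear U h W Z :
  hmetric U (h *: W + Z) = h * hmetric U W + hmetric U Z.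
Proof. by rewrite /hmetric !metricE; ring. Qed.

Lemma lie_xi_metric U W : lie_form g xi U W = 2 * hmetric U W.
Proof.
rewrite /lie_form /hmetric !(bracket_nabla hnabla) !nabla_xi.
rewrite (vderiv_metric hnabla) !metricE (metricC hg xi W); ring.
Qed.

(** By [nabla_xi] the covariant derivative of [eta] is the symmetric form [hmetric], so [eta] is
    closed. *)
Lemma eta_closed U W :
  vderiv U (g W xi) - vderiv W (g U xi) = g (lie_bracket U W) xi.
Proof.
rewrite (bracket_nabla hnabla) !(vderiv_metric hnabla) !nabla_xi !metricE.
by rewrite (metricC hg W U); ring.
Qed.

Lemma lie_xi_eta U : vderiv xi (g U xi) = g (lie_bracket xi U) xi.
Proof. by rewrite -eta_closed metric_xi vderiv1r subr0. Qed.

(** The Kenmotsu identity makes [phi] parallel along [xi], and [phi] commutes with [nabla _ xi]. *)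
Lemma lie_xi_phi U : lie_bracket xi (phi U) = phi (lie_bracket xi U).
Proof.
have := hken xi U; rewrite /covariant_endo phi_xi (metric0l hg) scale0r.
rewrite scaler0 subrr => /eqP; rewrite subr_eq0 => /eqP e.
rewrite !(bracket_nabla hnabla) !nabla_xi metric_phi_xi scale0r subr0 e.
by rewrite linearB linearB linearZ /= phi_xi scaler0 subr0.
Qed.

Lemma vderiv_hmetric U W Z : vderiv U (hmetric W Z) =
  hmetric (nabla U W) Z + hmetric W (nabla U Z)
  - hmetric U W * g Z xi - g W xi * hmetric U Z.
Proof.
rewrite /hmetric !vderivE !(vderiv_metric hnabla) !nabla_xi !metricE.
by rewrite (metricC hg W U) (metricC hg Z U); ring.
Qed.

(* Both sides differ by a tensor that is symmetric in [U, W], by torsion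
   freeness, and skew in its last two arguments once paired with [g], by
   compatibility; such a tensor vanishes. *)
Lemma lie_xi_nabla U W : lie_bracket xi (nabla U W) =
  nabla (lie_bracket xi U) W + nabla U (lie_bracket xi W)
  - (2 * hmetric U W) *: xi.
Proof.
pose T U W := lie_bracket xi (nabla U W) - nabla (lie_bracket xi U) W
  - nabla U (lie_bracket xi W) + (2 * hmetric U W) *: xi.
suff T0 U' W' : T U' W' = 0.
  apply/eqP; rewrite -subr_eq0 -(T0 U W) /T; apply/eqP.
  by apply: vector_field_ext => f; rewrite !vderivE; ring.
have swapE U1 W1 : nabla U1 W1 = nabla W1 U1 + lie_bracket U1 W1.
  by rewrite (bracket_nabla hnabla) addrCA subrr addr0.
have T_sym U1 W1 : T U1 W1 = T W1 U1.
  rewrite /T hmetricC (swapE U1 W1) (swapE _ W1) (swapE U1) bracketDr.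
  by rewrite jacobi; apply: vector_field_ext => f; rewrite !vderivE; ring.
have T_skew U1 W1 Z1 : g (T U1 W1) Z1 = - g (T U1 Z1) W1.
  have lieE A B : g (lie_bracket xi A) B = vderiv xi (g A B) -
      g A (lie_bracket xi B) - 2 * hmetric A B.
    by rewrite -lie_xi_metric /lie_form; ring.
  have xi_metricE : vderiv xi (g (nabla U1 W1) Z1) =
      vderiv (lie_bracket xi U1) (g W1 Z1) + vderiv U1 (vderiv xi (g W1 Z1))
      - vderiv xi (g (nabla U1 Z1) W1).
    rewrite vderiv_bracket (vderiv_metric hnabla U1) vderivDr.
    by rewrite (metricC hg W1 (nabla _ _)); ring.
  have xi_gE : vderiv xi (g W1 Z1) = g (lie_bracket xi W1) Z1 +
      g W1 (lie_bracket xi Z1) + 2 * hmetric W1 Z1.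
    by rewrite -lie_xi_metric /lie_form; ring.
  rewrite /T !metricE !lieE xi_metricE xi_gE !vderivDr vderiv2r.
  rewrite vderiv_hmetric !(vderiv_metric hnabla) /hmetric.
  rewrite !(metricC hg W1 (nabla _ _)) !(metricC hg (lie_bracket xi W1)).
  by rewrite (metricC hg xi W1) (metricC hg xi Z1); ring.
apply: (metric_ext hg) => Z; rewrite (metric0l hg).
apply: smooth_fun_mul2I; rewrite mulr0.
(* Alternating the two swaps three times restores the order of the arguments and picks up three
   signs. *)
have e : g (T U' W') Z = - g (T U' W') Z.
  rewrite {1}T_sym T_skew T_sym T_skew opprK T_sym T_skew T_sym //.
by rewrite mulrDl mul1r {1}e addNr.
Qed.

(** The correction is the skew part of the covariant derivative of [-2 h (x) xi] from
    [lie_xi_nabla]; its [xi] components cancel. *)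
Lemma lie_xi_curvature U V W :
  lie_bracket xi (curvature nabla U V W) =
  curvature nabla (lie_bracket xi U) V W
  + curvature nabla U (lie_bracket xi V) W
  + curvature nabla U V (lie_bracket xi W)
  - 2 *: (hmetric V W *: U - hmetric U W *: V).
Proof.
have hbracket : hmetric (lie_bracket U V) W =
    hmetric (nabla U V) W - hmetric (nabla V U) W.
  by rewrite (bracket_nabla hnabla) /hmetric !metricE; ring.
rewrite /curvature !(bracketDr, bracketNr, lie_xi_nabla) jacobi hbracket.
rewrite !(nablaDl hnabla, nablaDr hnabla, nablaNr hnabla, nablaZr hnabla).
rewrite !vderiv2r !vderiv_hmetric !nabla_xi (hmetricC V U).
apply: vector_field_ext => f.
rewrite !(vderivDl, vderivNl, vderivZl).
by ring.
Qed.

(** * The star-Ricci tensor and its Lie derivative along [xi] *)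

Section StarRicci.
Variables (S : X -> X -> C).
Hypothesis (hS : star_ricci nabla phi S).

Lemma star_ricci_trace U W p :
  trace_at p (fun Z => curvature nabla U (phi W) (phi Z)) ((2 * S U W) p).
Proof.
have [t At St] := hS U W p.
suff -> : (2 * S U W) p = t by [].
rewrite -[LHS]/(2 * S U W p) St mulrA mulfV ?mul1r // pnatr_eq0 //.
Qed.

(** Every witness of [trace_at] contains a frame. *)
Lemma frame_at_exists p : exists E : 'I_m -> X, frame_at p E.
Proof. by have [E [a [Ep _ _]]] := star_ricci_trace xi xi p; exists E. Qed.

Lemma star_ricci_xi U : S U xi = 0.
Proof.
apply: smooth_fun_mul2I; rewrite mulr0; apply: smooth_fun_ext => p.
have [E [a [[indE _] AE ->]]] := star_ricci_trace U xi p.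
rewrite /mxtrace big1 // => i _; apply: (indE (a^~ i)) => f.
by rewrite -AE phi_xi (curvature0 hnabla).
Qed.

(** As [xi] preserves [phi], the only correction under the trace comes from [lie_xi_curvature]: two
    rank-one terms, with forms [th1] and [th2], of traces [h] and [-h]. *)
Lemma lie_xi_star_ricci U W : lie_form S xi U W = - (2 * hmetric U W).
Proof.
apply: smooth_fun_mul2I.
apply: smooth_fun_ext => p.
have [D [E [f [w [loc Dp]]]]] := local_frame_exists p frame_at_exists.
pose A U W Z := curvature nabla U (phi W) (phi Z).
have lA U' W' : tensorial (A U' W').
  by move=> h Z Z'; rewrite /A linearP; exact: (curvature_tensorial hnabla).
have trA U' W' : frame_trace E f w (A U' W') = D * (2 * S U' W').
  by apply: (frame_traceE loc) => // q; exact: star_ricci_trace.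
pose th1 Z : C^o := hmetric (phi W) (phi Z).
pose th2 Z : C^o := hmetric U (phi Z).
have lth1 : tensorial th1.
  by move=> h Z Z'; rewrite /th1 linearP; exact: hmetric_linear.
have lth2 : tensorial th2.
  by move=> h Z Z'; rewrite /th2 linearP; exact: hmetric_linear.
have th1E : th1 U = hmetric U W.
  rewrite /th1 /hmetric metric_phi !metric_phi_xi mulr0 subr0.
  exact: hmetricC.
have th2E : th2 (phi W) = - hmetric U W.
  rewrite /th2 {1}/hmetric metric_phi_xi mulr0 subr0 phi2 !metricE /hmetric.
  ring.
have tr_lie : frame_trace E f w
    (fun Z => lie_bracket xi (A U W Z) - A U W (lie_bracket xi Z)) =
    frame_trace E f w (A (lie_bracket xi U) W) +
    frame_trace E f w (A U (lie_bracket xi W)) -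
    2 * (D * th1 U - D * th2 (phi W)).
  rewrite -!(frame_trace_rank1 _ loc) // /frame_trace -sumrB mulr_sumr.
  rewrite -big_split -sumrB; apply: eq_bigr => i _ /=.
  rewrite /A lie_xi_curvature !lie_xi_phi -/(th1 (E i)) -/(th2 (E i)).
  set a := curvature _ (lie_bracket xi U) _ _.
  set b := curvature _ U (phi (lie_bracket xi W)) _.
  rewrite addrAC addrK addrC -scaleNr coframe_linear coframeD.
  rewrite -[- (_ *: phi W)]scaleN1r coframeD [coframe f w i (-1 *: _)]coframeZ.
  ring.
have := frame_trace_lie xi loc (lA U W).
rewrite tr_lie !trA vderivMr vderiv2r th1E th2E => e.
(* The derivatives of [D] cancel, leaving the claim times the square of [D], which is nonzero at
   [p]. *)
have {}e : D * D * (2 * lie_form S xi U W) = D * D * (2 * - (2 * hmetric U W)).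
  rewrite /lie_form; transitivity (D * (vderiv xi D * (2 * S U W) +
    D * (2 * vderiv xi (S U W))) - vderiv xi D * (D * (2 * S U W))
    - D * D * (2 * (S (lie_bracket xi U) W + S U (lie_bracket xi W)))).
    ring.
  rewrite -e; ring.
have DDp : (D * D) p != 0 by rewrite smooth_funM mulf_neq0.
by apply: (mulfI DDp); rewrite -!smooth_funM e.
Qed.

(** * Consequences of the soliton equation *)

Section Soliton.
Variables (V : X) (lambda : R).
Hypothesis (hsol : star_ricci_soliton g S V lambda).

Let l : C := smooth_cst M lambda.
Let xiV := lie_bracket xi V.

Lemma solitonE U W : lie_form g V U W = - (2 * (S U W + l * g U W)).
Proof.
have := hsol U W; rewrite -[lie_metric _ _ _ _]/(lie_form g V U W) -/l => e.
by apply/eqP; rewrite -subr_eq0 -e; apply/eqP; ring.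
Qed.

Lemma metric_xiV U : g U xiV =
  - (2 * l * g U xi) - (vderiv V (g U xi) - g (lie_bracket V U) xi).
Proof.
have := solitonE U xi; rewrite /lie_form star_ricci_xi (bracketC V xi) -/xiV.
rewrite !metricE => e.
have -> : g U xiV = vderiv V (g U xi) - g (lie_bracket V U) xi - - g U xiV
  - (vderiv V (g U xi) - g (lie_bracket V U) xi) by ring.
by rewrite e; ring.
Qed.

(** At [U = xi] the unknown occurs on both sides of [metric_xiV], whence the doubling. *)
Lemma eta_xiV : g xiV xi = - l.
Proof.
apply: smooth_fun_mul2I; rewrite mulrDl mul1r {1}(metricC hg) metric_xiV.
by rewrite metric_xi vderiv1r (bracketC V xi) metricE; ring.
Qed.

(** By [metric_xiV] the form dual to [xiV] is [-2 l eta - L_V eta]. It is invariant under [xi]: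
    [L_xi eta = 0], and [L_xiV eta = 0] since [eta] is closed and [eta xiV] is constant. So
    [[xi, xiV]] comes only from [L_xi g]. *)
Lemma bracket_xi_xiV : lie_bracket xi xiV = - (2 *: (xiV + l *: xi)).
Proof.
apply: (metric_ext hg) => U; rewrite ![g _ U](metricC hg).
have e1 : vderiv xi (g U xiV) - g (lie_bracket xi U) xiV = 0.
  rewrite metric_xiV (metric_xiV (lie_bracket xi U)) !(vderivBr, vderivNr).
  rewrite vderivMr vderiv2r vderiv_cst !lie_xi_eta jacobi (metricDl hg).
  rewrite -/xiV -(eta_closed xiV U) eta_xiV vderivNr vderiv_cst.
  rewrite vderiv_bracket lie_xi_eta.
  ring.
have e2 := lie_xi_metric U xiV.
have -> : g U (lie_bracket xi xiV) = vderiv xi (g U xiV)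
    - g (lie_bracket xi U) xiV - lie_form g xi U xiV by rewrite /lie_form; ring.
by rewrite e1 e2 /hmetric eta_xiV !metricE; ring.
Qed.

Let horizontal U := g U xi = 0.

Lemma hmetric_horizontal U W : horizontal U -> hmetric U W = g U W.
Proof. by rewrite /horizontal /hmetric => ->; rewrite mul0r subr0. Qed.

Lemma bracket_xi_horizontal U : horizontal U -> horizontal (lie_bracket xi U).
Proof. by rewrite /horizontal -lie_xi_eta => ->; exact: vderiv0r. Qed.

(** Every term of the derivative of [eta (x) eta] keeps a factor [eta U] or [eta W]; the brackets
    with [Z] need not be horizontal. *)
Lemma lie_form_hmetric Z U W : horizontal U -> horizontal W ->
  lie_form (lie_form g xi) Z U W = 2 * lie_form g Z U W.
Proof.
move=> hU hW; rewrite {1}/lie_form !lie_xi_metric.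
rewrite vderiv2r hmetric_horizontal // (hmetricC _ W) hmetric_horizontal //.
by rewrite hmetric_horizontal // (metricC hg W) /lie_form; ring.
Qed.

Lemma metric_biadditive : biadditive g.
Proof. by split=> *; rewrite metricE. Qed.

(** The contributions of [l] to the two orders of differentiation cancel. *)
Lemma lie_xiV_metric U W : horizontal U -> horizontal W ->
  lie_form g xiV U W = 2 * (2 * (g U W + S U W)).
Proof.
move=> hU hW; have := lie_form_commutator xi V U W metric_biadditive.
rewrite lie_form_hmetric // solitonE {1}/lie_form !solitonE => e.
have -> : lie_form g xiV U W =
    2 * (2 * (S U W + l * g U W)) - 2 * lie_form S xi U W
    - 2 * (l * lie_form g xi U W).
  apply: (addrI (2 * - (2 * (S U W + l * g U W)))); rewrite -e /lie_form.
  by rewrite vderivNr vderiv2r vderivDr vderivMr vderiv_cst; ring.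
rewrite lie_xi_star_ricci lie_xi_metric hmetric_horizontal //; ring.
Qed.

Lemma lie_form_bracket_xi_xiV U :
  lie_form g (lie_bracket xi xiV) U U =
  - (2 * (lie_form g xiV U U + l * lie_form g xi U U)).
Proof.
rewrite bracket_xi_xiV scaler_nat mulr2n /lie_form.
rewrite ![lie_bracket _ U]bracketC !(bracketNr, bracketDr, bracketZr).
rewrite !(vderivNl, vderivDl, vderivZl) vderiv_cst !metricE; ring.
Qed.

(** In the commutator of [xi] and [xiV] the terms [2 L_xiV g] cancel, leaving [-4 l g]; on the other
    side [L_xi g + L_xi S = 0]. *)
Lemma soliton_metric_horizontal U : horizontal U -> l * g U U = 0.
Proof.
move=> hU; have hU1 := bracket_xi_horizontal hU.
have := lie_form_commutator xi xiV U U metric_biadditive.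
rewrite lie_form_hmetric // lie_form_bracket_xi_xiV {1}/lie_form.
rewrite !lie_xiV_metric // !vderiv2r => e.
have lS := lie_xi_star_ricci U U; have lg := lie_xi_metric U U.
rewrite hmetric_horizontal // in lS lg.
have lgS : lie_form g xi U U + lie_form S xi U U = 0 by rewrite lS lg subrr.
do 2![apply: smooth_fun_mul2I; rewrite mulr0].
rewrite lg in e.
rewrite -[RHS](_ : - (2 * (2 * (lie_form g xi U U + lie_form S xi U U))) = 0);
  last by rewrite lgS !mulr0 oppr0.
transitivity (- (2 * (2 * (2 * (g U U + S U U))) -
  2 * (2 * (2 * (g U U + S U U)) + l * (2 * g U U)))); first by ring.
by rewrite -e vderivDr /lie_form; ring.
Qed.
End Soliton.
End StarRicci.
End Kenmotsu.

(** * Conclusion from linear independence of a frame at one point *)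

Theorem theorem3p1 (R : realType) (n : nat) (hn : (1 <= n)%N)
    (M : manifold R (2 * n + 1))
    (phi : {linear vector_field M -> vector_field M})
    (xi : vector_field M)
    (eta : {linear vector_field M -> (smooth_fun M)^o})
    (g : vector_field M -> vector_field M -> smooth_fun M)
    (nabla : vector_field M -> vector_field M -> vector_field M)
    (Sstar : vector_field M -> vector_field M -> smooth_fun M)
    (hacm : almost_contact_metric phi xi eta g)
    (hnabla : levi_civita g nabla)
    (hkenmotsu : kenmotsu phi xi eta g nabla)
    (hSstar : star_ricci nabla phi Sstar)
    (V : vector_field M) (lambda : R)
    (hsoliton : star_ricci_soliton g Sstar V lambda) :
  lambda = 0.
Proof.
have hg := acm_metric hacm; have [p _] := manifold_nonempty M.
have [E [indE _]] := frame_at_exists xi hSstar p.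
apply/eqP; apply: contrapT => /negP l0.
(* If [lambda] were nonzero, horizontal fields would vanish at [p] by positivity, so each [E i]
   would be a multiple of [xi] there. *)
have EE i f : E i f p = g (E i) xi p * xi f p.
  apply/eqP; apply: contrapT => /negP neq.
  pose U := E i - g (E i) xi *: xi.
  have hU : g U xi = 0.
    by rewrite !(metricE hg) (metric_xi hacm) mulr1 subrr.
  have Up : nonzero_at p U.
    by exists f; rewrite -[U f p]/(E i f p - g (E i) xi p * xi f p) subr_eq0.
  have := soliton_metric_horizontal hacm hnabla hkenmotsu hSstar hsoliton hU.
  move/(congr1 (fun f : smooth_fun M => f p)); rewrite smooth_funM => /eqP.
  by rewrite mulf_eq0 (negPf l0) gt_eqF // (metric_pos hg Up).
have i0 : (0 < 2 * n + 1)%N by rewrite addn1.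
have i1 : (1 < 2 * n + 1)%N by rewrite addn1 ltnS muln_gt0.
pose i : 'I_(2 * n + 1) := Ordinal i0; pose j : 'I_(2 * n + 1) := Ordinal i1.
(* Two multiples of [xi] satisfy the relation with coefficients [c], so independence kills the [xi]
   component of [E j], and [E j] itself vanishes at [p]. *)
have bj0 : g (E j) xi p = 0.
  pose c k := if k == i then g (E j) xi p
              else if k == j then - g (E i) xi p else 0.
  apply: (indE c _ i) => f; rewrite (bigD1 i) //= (bigD1 j) //= big1 => [|k].
    by rewrite /c /= !EE; ring.
  by rewrite /c => /andP[/negPf-> /negPf->]; rewrite mul0r.
have := indE (fun k => (k == j)%:R) _ j; rewrite eqxx => one0.
have /eqP : 1 = 0 :> R.
  apply: one0 => f; rewrite (bigD1 j) // big1 => [|k /= /negPf->].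
    by rewrite /= EE bj0 mul0r mulr0 addr0.
  by rewrite mul0r.
by rewrite oner_eq0.
Qed.
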